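(* For $R>0$, $T\in\mathbb N$ with $T\ge1$, a noise sequence $\{\sigma_k\}$ and an upper bound $M$ with $0<\sigma_k\le M$ for all $k$, define $$\epsilon_{\text{worst}}=\frac{2RM}{\sqrt T},\qquad \epsilon_{\text{agnostic}}=\frac{1}{\sqrt T}\Big(R^2+\frac1T\sum_{k=1}^T\sigma_k^2\Big),$$ $$\epsilon_{\text{adaptive}}=\frac{2R}{\sqrt T}\Big(\frac1T\sum_{k=1}^T\sigma_k^2\Big)^{1/2},\qquad \epsilon_{\text{dynamic}}=\frac{2R}{\sqrt T}\Big(\frac1T\sum_{k=1}^T\frac1{\sigma_k}\Big)^{-1}.$$ Then $$\epsilon_{\text{dynamic}}\preceq\epsilon_{\text{adaptive}}\preceq\min\{\epsilon_{\text{worst}},\epsilon_{\text{agnostic}}\}.$$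
   Context: Dominating bounds: an error bound $\epsilon_1$ dominates another error bound $\epsilon_2$, denoted $\epsilon_1\preceq\epsilon_2$, if there exists an absolute constant $c>0$ such that for all $R,T,\{\sigma_k\}_k$ (and all $M$ with $M\ge\sigma_k$ for every $k$, where $M$ appears) the instantiated values satisfy $\epsilon_1(R,T,\{\sigma_k\}_k)\le c\,\epsilon_2(R,T,\{\sigma_k\}_k)$. *)

(* Defs.v *)
From mathcomp Require Import all_boot all_order all_algebra.
From mathcomp Require Import reals.

Set Implicit Arguments.
Unset Strict Implicit.
Unset Printing Implicit Defensive.

Import Order.TTheory GRing.Theory Num.Theory.
Local Open Scope ring_scope.

(* An error bound is a function of the radius [r] (written R in the
   mathematics; here [R] is the field of real numbers), the horizon [T], the
   noise sequence [sigma] and the upper bound [M] on the noise.  All error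
   bounds share this signature, including those that ignore [M]. *)
Definition error_bound (R : realType) : Type :=
  R -> nat -> (nat -> R) -> R -> R.

(* The noise levels are sigma_1, ..., sigma_T; the values of [sigma] outside
   1..T are irrelevant and left unconstrained. *)
Definition admissible (R : realType)
    (r : R) (T : nat) (sigma : nat -> R) (M : R) : Prop :=
  [/\ 0 < r, (1 <= T)%N &
      forall k : nat, (1 <= k <= T)%N -> 0 < sigma k <= M].

(* The constant is absolute: it is chosen before r, T, sigma and M. *)
Definition dominates (R : realType) (e1 e2 : error_bound R) : Prop :=
  exists2 c : R, 0 < c &
    forall (r : R) (T : nat) (sigma : nat -> R) (M : R),
      admissible r T sigma M -> e1 r T sigma M <= c * e2 r T sigma M.

Definition min_bound (R : realType) (e1 e2 : error_bound R) : error_bound R :=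
  fun r T sigma M => Num.min (e1 r T sigma M) (e2 r T sigma M).

Definition eps_worst (R : realType) : error_bound R :=
  fun r T sigma M => 2 * r * M / Num.sqrt T%:R.

Definition eps_agnostic (R : realType) : error_bound R :=
  fun r T sigma M =>
    1 / Num.sqrt T%:R
    * (r ^+ 2 + 1 / T%:R * \sum_(1 <= k < T.+1) sigma k ^+ 2).

Definition eps_adaptive (R : realType) : error_bound R :=
  fun r T sigma M =>
    2 * r / Num.sqrt T%:R
    * Num.sqrt (1 / T%:R * \sum_(1 <= k < T.+1) sigma k ^+ 2).

Definition eps_dynamic (R : realType) : error_bound R :=
  fun r T sigma M =>
    2 * r / Num.sqrt T%:R
    * (1 / T%:R * \sum_(1 <= k < T.+1) 1 / sigma k)^-1.

Arguments eps_worst R : clear implicits.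
Arguments eps_agnostic R : clear implicits.
Arguments eps_adaptive R : clear implicits.
Arguments eps_dynamic R : clear implicits.

(* Main.v *)
Require Import Defs.
From mathcomp Require Import all_boot all_order all_algebra.
From mathcomp Require Import reals.
From mathcomp Require Import ring.

(** All four bounds carry the factor [1 / sqrt T], and the constant 1 works
    throughout.  With [s] the quadratic mean of the noise levels, what remains
    is:
    - dynamic against adaptive: the harmonic mean is at most the quadratic mean.
      The function [u |-> 1 / sqrt u] is convex, so it lies above its tangent at
      [u = s ^+ 2] ([inv_ge_tangent]); evaluated at [u = sigma k ^+ 2] and
      averaged over [k], the linear term of the tangent vanishes by the choice
      of [s], leaving [1 / s <= mean (1 / sigma)] ([harmonic_le_quadratic]).
    - adaptive against worst: [s <= M], since every [sigma k ^+ 2] is at most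
      [M ^+ 2] ([quadratic_le_bound]).
    - adaptive against agnostic: [2 * r * s <= r ^+ 2 + s ^+ 2], because
      [(r - s) ^+ 2] is nonnegative. *)

Set Implicit Arguments.
Unset Strict Implicit.
Unset Printing Implicit Defensive.

Import Order.TTheory GRing.Theory Num.Theory.
Local Open Scope ring_scope.

Definition mean (F : fieldType) (T : nat) (a : nat -> F) : F :=
  1 / T%:R * \sum_(1 <= k < T.+1) a k.

Lemma mean_affine (F : numFieldType) (T : nat) (c d : F) (a : nat -> F) :
  (1 <= T)%N -> mean T (fun k => c + d * a k) = c + d * mean T a.
Proof.
move=> T1; rewrite /mean big_split /= -mulr_sumr sumr_const_nat subSS subn0.
have T0 : T%:R != 0 :> F by rewrite pnatr_eq0 -lt0n.
by rewrite -mulr_natr; field.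
Qed.

Lemma mean_cst (F : numFieldType) (T : nat) (c : F) :
  (1 <= T)%N -> mean T (fun=> c) = c.
Proof.
move=> T1; have := mean_affine c 0 (fun=> 0) T1.
by rewrite !mul0r addr0.
Qed.

Lemma ler_mean (F : numFieldType) (T : nat) (a b : nat -> F) :
  (forall k, (1 <= k <= T)%N -> a k <= b k) -> mean T a <= mean T b.
Proof.
move=> ab; apply: ler_wpM2l; first by rewrite divr_ge0 ?ler01 ?ler0n.
by rewrite ler_sum_nat.
Qed.

Lemma mean_gt0 (F : numFieldType) (T : nat) (a : nat -> F) :
  (1 <= T)%N -> (forall k, (1 <= k <= T)%N -> 0 < a k) -> 0 < mean T a.
Proof.
move=> T1 a0; apply: mulr_gt0; first by rewrite divr_gt0 ?ltr01 ?ltr0n.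
rewrite big_nat_recl //=; apply: ltr_wpDr; last by apply: a0.
rewrite big_nat_cond sumr_ge0 // => k /andP[/andP[k1 kT] _].
by apply/ltW/a0.
Qed.

(** The left-hand side is the tangent of [u |-> 1 / sqrt u] at [u = s ^+ 2],
    evaluated at [u = x ^+ 2].  After clearing denominators the gap is
    [(x - s) ^+ 2 * (x + 2 * s)]. *)
Lemma inv_ge_tangent (F : realFieldType) (s x : F) :
  0 < s -> 0 < x -> 3 / (2 * s) + - (2 * s ^+ 3)^-1 * x ^+ 2 <= 1 / x.
Proof.
move=> s0 x0; rewrite -subr_ge0.
have -> : 1 / x - (3 / (2 * s) + - (2 * s ^+ 3)^-1 * x ^+ 2)
          = (x - s) ^+ 2 * (x + 2 * s) / (2 * s ^+ 3 * x).
  by field; rewrite !lt0r_neq0.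
have [ges gex] := (ltW s0, ltW x0).
by rewrite divr_ge0 ?(mulr_ge0 (sqr_ge0 _)) ?addr_ge0 ?mulr_ge0 ?exprn_ge0.
Qed.

Lemma harmonic_le_quadratic (F : rcfType) (T : nat) (a : nat -> F) :
  (1 <= T)%N -> (forall k, (1 <= k <= T)%N -> 0 < a k) ->
  (mean T (fun k => 1 / a k))^-1 <= Num.sqrt (mean T (fun k => a k ^+ 2)).
Proof.
move=> T1 a0; set m2 := mean T (fun k => a k ^+ 2); set s := Num.sqrt m2.
have m20 : 0 < m2 by apply: mean_gt0 => // k /a0 ak0; rewrite exprn_gt0.
have s0 : 0 < s by rewrite sqrtr_gt0.
have tangent_le : 1 / s <= mean T (fun k => 1 / a k).
  have -> : 1 / s = mean T (fun k => 3 / (2 * s) + - (2 * s ^+ 3)^-1 * a k ^+ 2).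
    rewrite mean_affine // -/m2 -(sqr_sqrtr (ltW m20)) -/s.
    by field; rewrite !lt0r_neq0.
  by apply: ler_mean => k /a0; apply: inv_ge_tangent.
rewrite -[leRHS]invrK lef_pV2 ?posrE ?invr_gt0 //; first by rewrite -div1r.
by apply: mean_gt0 => // k /a0 ak0; rewrite divr_gt0.
Qed.

Lemma quadratic_le_bound (F : rcfType) (T : nat) (a : nat -> F) (M : F) :
  (1 <= T)%N -> (forall k, (1 <= k <= T)%N -> 0 <= a k <= M) ->
  Num.sqrt (mean T (fun k => a k ^+ 2)) <= M.
Proof.
move=> T1 aM.
have M0 : 0 <= M by case/andP: (aM 1%N T1) => /le_trans; apply.
rewrite -[leRHS]ger0_norm // -sqrtr_sqr ler_wsqrtr // -[leRHS](mean_cst _ T1).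
apply: ler_mean => k /aM /andP[ak0 akM].
by rewrite ler_sqr ?nnegrE.
Qed.

Theorem lemma2p6 (R : realType) :
  dominates (eps_dynamic R) (eps_adaptive R) /\
  dominates (eps_adaptive R) (min_bound (eps_worst R) (eps_agnostic R)).
Proof.
split; exists 1 => // r T sigma M [r0 T1 sigmaM]; rewrite mul1r;
  have sqT0 : 0 <= (Num.sqrt T%:R)^-1 :> R by rewrite invr_ge0 sqrtr_ge0.
- apply: ler_wpM2l; first by rewrite !mulr_ge0 ?(ltW r0).
  by apply: harmonic_le_quadratic => // k /sigmaM /andP[].
- rewrite /min_bound le_min /eps_adaptive /eps_worst /eps_agnostic.
  rewrite -!/(mean T (fun k => sigma k ^+ 2)).
  set m2 := mean _ _; set s := Num.sqrt m2.
  have m20 : 0 <= m2.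
    by apply/ltW/mean_gt0 => // k /sigmaM /andP[sk0 _]; rewrite exprn_gt0.
  apply/andP; split.
  + rewrite [leRHS]mulrAC ler_wpM2l ?mulr_ge0 ?(ltW r0) //.
    by apply: quadratic_le_bound => // k /sigmaM /andP[/ltW -> ->].
  + rewrite mulrAC [leRHS]mulrC mulrA mulr1 ler_wpM2r //.
    rewrite -(sqr_sqrtr m20) -/s -subr_ge0.
    have -> : r ^+ 2 + s ^+ 2 - 2 * r * s = (r - s) ^+ 2 by ring.
    exact: sqr_ge0.
Qed.
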